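(* Let $Q$ be a quantum CSS code of length $n$ and dimension $k$, with spaces $\xi,\eta\subset\mathbb{F}_2^n$ of degenerate $X$- and $Z$-codewords. If $\alpha\subset\mathbb{F}_2^n$ is a subspace such that $\alpha=\alpha^\bot$, then $\alpha$ contains representatives of $k$ independent logical operators of the code $Q$; that is, there are nonnegative integers $a,b$ with $a+b=k$, $a$ linearly independent classes in $\eta^\bot/\xi$ (logical $X$-operators) having representatives in $\alpha\cap\eta^\bot$, and $b$ linearly independent classes in $\xi^\bot/\eta$ (logical $Z$-operators) having representatives in $\alpha\cap\xi^\bot$.
   Context: The orthogonal complement ${}^\bot$ in $\mathbb{F}_2^n$ is with respect to the form $(u,v)=\sum_{i=1}^n u_iv_i$. A CSS code of length $n$ is given by two matrices $H_x$ ($m_1\times n$) and $H_z$ ($m_2\times n$) over $\mathbb{F}_2$ with $H_xH_z^T=0$. The spaces of degenerate $X$- and $Z$-codewords are the row spaces $\xi$ of $H_x$ and $\eta$ of $H_z$; thus $\xi\subset\eta^\bot$ and $\eta\subset\xi^\bot$. The space of $X$-codewords is $\eta^\bot=\ker H_z$, the space of $Z$-codewords is $\xi^\bot=\ker H_x$; logical $X$-operators up to equivalence form the space $\eta^\bot/\xi$, logical $Z$-operators up to equivalence form $\xi^\bot/\eta$. The dimension of the code is $k=n-\dim\xi-\dim\eta=\dim(\eta^\bot/\xi)=\dim(\xi^\bot/\eta)$. *)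

(* Defs.v *)
From HB Require Import structures.
From mathcomp Require Import all_boot all_order all_algebra.

Set Implicit Arguments.
Unset Strict Implicit.
Unset Printing Implicit Defensive.

Import GRing.Theory.
Local Open Scope ring_scope.
Local Open Scope quotient_scope.

Section QuotientSpace.
Variables (K : fieldType) (V : vectType K) (W : {vspace V}).

Definition quotv := Quotient.quot (pred_of_vspace W).

HB.instance Definition _ := GRing.Zmodule.on quotv.

Definition quotv_class (v : V) : quotv := \pi_quotv v.

Lemma eq_quotv_class (u v : V) :
  (quotv_class u == quotv_class v) = (u - v \in W).
Proof. by rewrite [RHS]Quotient.idealrBE. Qed.

Lemma quotv_reprK : cancel (fun x : quotv => repr x) quotv_class.
Proof. exact: reprK. Qed.

Lemma quotv_classD (u v : V) :
  quotv_class (u + v) = quotv_class u + quotv_class v.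
Proof. by rewrite /quotv_class; rewrite !piE. Qed.

Definition quotv_scale (a : K) (x : quotv) : quotv := quotv_class (a *: repr x).

Lemma quotv_classZ a v : quotv_scale a (quotv_class v) = quotv_class (a *: v).
Proof.
apply/eqP; rewrite eq_quotv_class -scalerBr rpredZ // -eq_quotv_class.
by rewrite quotv_reprK.
Qed.

Fact quotv_scaleA a b x :
  quotv_scale a (quotv_scale b x) = quotv_scale (a * b) x.
Proof. by rewrite -(quotv_reprK x) !quotv_classZ scalerA. Qed.

Fact quotv_scale1 : left_id 1 quotv_scale.
Proof. by move=> x; rewrite -(quotv_reprK x) quotv_classZ scale1r. Qed.

Fact quotv_scaleDr : right_distributive quotv_scale +%R.
Proof.
move=> a x y; rewrite -(quotv_reprK x) -(quotv_reprK y) -quotv_classD.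
by rewrite !quotv_classZ scalerDr quotv_classD.
Qed.

Fact quotv_scaleDl x : {morph quotv_scale^~ x : a b / a + b}.
Proof.
move=> a b /=; rewrite -(quotv_reprK x) !quotv_classZ scalerDl.
by rewrite quotv_classD.
Qed.

HB.instance Definition _ := GRing.Zmodule_isLmodule.Build K quotv
  quotv_scaleA quotv_scale1 quotv_scaleDr quotv_scaleDl.

Fact quotv_class_is_linear : linear quotv_class.
Proof. by move=> a u v; rewrite quotv_classD -quotv_classZ. Qed.

HB.instance Definition _ :=
  GRing.isLinear.Build K V quotv _ quotv_class quotv_class_is_linear.

Lemma quotv_class_eq0 v : (quotv_class v == 0) = (v \in W).
Proof. by rewrite -(linear0 quotv_class) eq_quotv_class subr0. Qed.

Fact quotv_vect_iso : Vector.axiom (\dim (W^C)%VS) quotv.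
Proof.
pose f (x : quotv) : 'rV_(\dim (W^C)%VS) :=
  \row_i coord (vbasis (W^C)%VS) i (daddv_pi W^C W (repr x)).
have dWC : (W^C :&: W = 0)%VS by rewrite capvC capv_compl.
have piW v : v \in W -> daddv_pi W^C W v = 0.
  move=> vW; apply: (addIr v); rewrite add0r.
  rewrite -{2}(daddv_pi_id (capv_compl W) vW) daddv_pi_add //.
  exact: subvP (addvSr _ _) v vW.
have fc v : f (quotv_class v) =
    \row_i coord (vbasis (W^C)%VS) i (daddv_pi W^C W v).
  apply/rowP=> i; rewrite !mxE; congr (coord _ i _).
  apply: subr0_eq; rewrite -linearB; apply: piW.
  by rewrite -eq_quotv_class quotv_reprK.
exists f.
  move=> a x y; rewrite -(quotv_reprK x) -(quotv_reprK y) -linearP !fc.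
  by apply/rowP=> i; rewrite !mxE !linearP.
pose g (r : 'rV_(\dim (W^C)%VS)) :=
  quotv_class (\sum_i r 0 i *: (vbasis (W^C)%VS)`_i).
exists g => [x|r].
  rewrite -{2}(quotv_reprK x) -(quotv_reprK x) fc /g.
  under eq_bigr do rewrite mxE.
  rewrite -(coord_vbasis (memv_pi _ _ _)) quotv_reprK.
  apply/eqP; rewrite eq_quotv_class.
  have vT : repr x \in (W^C + W)%VS by rewrite addvC addv_complf memvf.
  rewrite -{2}(daddv_pi_add dWC vT) opprD addNKr rpredN.
  exact: memv_pi.
rewrite fc; apply/rowP=> i; rewrite mxE.
rewrite daddv_pi_id // ?coord_sum_free ?(basis_free (vbasisP _)) //.
by apply: rpred_sum => j _; rewrite rpredZ // vbasis_mem // mem_nth //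
  size_tuple.
Qed.

HB.instance Definition _ := Lmodule_hasFinDim.Build K quotv quotv_vect_iso.

Lemma dim_quotv : \dim {: quotv} = (\dim {: V} - \dim W)%N.
Proof. by rewrite {1}dimvf /dim /= dimv_compl. Qed.

End QuotientSpace.

Section Subquotient.
Variables (K : fieldType) (V : vectType K) (U W : {vspace V}).

(* U / W, for W contained in U; in general this is U / (U :&: W). *)
Definition subquotv :=
  quotv (linfun (vsval : subvs_of U -> V) @^-1: W)%VS.

HB.instance Definition _ := Vector.on subquotv.

(* The class of v in U / W is meaningful only for v \in U. *)
Definition subquotv_class (v : V) : subquotv := quotv_class _ (vsproj U v).

Lemma subquotv_class_is_linear : linear subquotv_class.
Proof. by move=> a u v; rewrite /subquotv_class !linearP. Qed.

HB.instance Definition _ :=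
  GRing.isLinear.Build K V subquotv _ subquotv_class subquotv_class_is_linear.

Lemma subquotv_class_eq0 v :
  v \in U -> (subquotv_class v == 0) = (v \in W).
Proof.
by move=> vU; rewrite [LHS]quotv_class_eq0 -memv_preim lfunE /= vsprojK.
Qed.

Lemma subquotv_class_surj (x : subquotv) :
  exists2 v, v \in U & subquotv_class v = x.
Proof.
exists (vsval (repr x)); first exact: subvsP.
by rewrite /subquotv_class vsvalK; apply: quotv_reprK.
Qed.

Lemma dim_subquotv : (W <= U)%VS -> \dim {: subquotv} = (\dim U - \dim W)%N.
Proof.
move=> sWU; rewrite [LHS]dim_quotv dimvf; congr (_ - _)%N.
set f := linfun _.
have kf : lker f == 0%VS.
  by apply/lker0P=> u v; rewrite !lfunE; apply: val_inj.
rewrite -(limg_dim_eq (f := f)); last by rewrite (eqP kf) capv0.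
rewrite lpreimK //; apply/subvP=> w /(subvP sWU) wU.
by rewrite -(vsprojK wU) -[vsval _](lfunE vsval) memv_img ?memvf.
Qed.

End Subquotient.

Section Orthogonal.
Variable n : nat.
Implicit Types (u v : 'rV['F_2]_n) (U : {vspace 'rV['F_2]_n}).

Definition dotp u v : 'F_2 := \sum_(i < n) u 0 i * v 0 i.

Lemma dotpC u v : dotp u v = dotp v u.
Proof. by apply: eq_bigr => i _; rewrite mulrC. Qed.

Fact dotp_is_scalar u : scalar (dotp u).
Proof.
move=> a v w; rewrite /dotp mulr_sumr -big_split /=.
by apply: eq_bigr => i _; rewrite !mxE mulrDr mulrCA.
Qed.

HB.instance Definition _ u := GRing.isLinear.Build 'F_2 'rV['F_2]_n 'F_2 _
  (dotp u) (dotp_is_scalar u).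

Definition orthv U : {vspace 'rV['F_2]_n} :=
  (\bigcap_(u | u \in U) lker (linfun (dotp u : _ -> ('F_2)^o)))%VS.

Lemma memv_orthv U v :
  reflect (forall u, u \in U -> dotp u v = 0) (v \in orthv U).
Proof.
rewrite memvE; apply: (iffP subv_bigcapP) => h u uU.
  by have := h u uU; rewrite -memvE memv_ker lfunE => /eqP.
by rewrite -memvE memv_ker lfunE /= h.
Qed.

Lemma dim_orthv U : \dim (orthv U) = (n - \dim U)%N.
Proof.
pose B := \matrix_(i < \dim U) (vbasis U)`_i.
have BE i : row i B = (vbasis U)`_i by rewrite rowK.
have freeB : row_free B.
  rewrite -kermx_eq0; apply/eqP/row_matrixP=> j; rewrite row0.
  set c := row j _; have cB : c *m B = 0 by rewrite -row_mul mulmx_ker row0.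
  apply/rowP=> i; rewrite [RHS]mxE.
  have /freeP/(_ (fun i => c 0 i)) := basis_free (vbasisP U); apply.
  by rewrite -[RHS]cB mulmx_sum_row; apply: eq_bigr => l _; rewrite BE.
pose f : 'Hom('rV['F_2]_n, 'rV['F_2]_(\dim U)) := linfun (mulmxr B^T).
have fE v i : (f v) 0 i = dotp (vbasis U)`_i v.
  rewrite lfunE /= mxE /dotp; apply: eq_bigr => l _.
  by rewrite -BE !mxE mulrC.
have -> : orthv U = lker f.
  apply/vspaceP=> v; rewrite memv_ker; apply/memv_orthv/eqP => [h|h u uU].
    apply/rowP=> i; rewrite fE mxE; apply: h.
    by rewrite vbasis_mem // mem_nth // size_tuple.
  rewrite dotpC (coord_vbasis uU) linear_sum big1 // => i _.
  by rewrite linearZ /= dotpC -fE h mxE mulr0.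
have := limg_ker_dim f fullv; rewrite capfv dimvf /dim /= mul1n => kf.
suff limf : limg f = fullv.
  by move: kf; rewrite limf dimvf /dim /= mul1n => /(canRL (addnK _)).
apply/vspaceP=> r; rewrite memvf.
have fullB : row_full B^T by rewrite /row_full mxrank_tr.
have -> : r = f (r *m pinvmx B^T) by rewrite lfunE /= mulmxKpV ?submx_full.
by rewrite memv_img ?memvf.
Qed.

End Orthogonal.

Record css_code (n : nat) := CSSCode {
  css_mx : nat;
  css_mz : nat;
  css_Hx : 'M['F_2]_(css_mx, n);
  css_Hz : 'M['F_2]_(css_mz, n);
  css_comm : css_Hx *m css_Hz^T = 0 }.

Definition row_space (m n : nat) (A : 'M['F_2]_(m, n)) : {vspace 'rV['F_2]_n} :=
  <<[seq row i A | i <- enum 'I_m]>>%VS.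

Section CSSCode.
Variables (n : nat) (Q : css_code n).

Definition degenX := row_space (css_Hx Q).
Definition degenZ := row_space (css_Hz Q).

Definition codewordX := orthv degenZ.
Definition codewordZ := orthv degenX.

Definition logicalX := subquotv codewordX degenX.
Definition logicalZ := subquotv codewordZ degenZ.

HB.instance Definition _ := Vector.on logicalX.
HB.instance Definition _ := Vector.on logicalZ.

Definition logicalX_class : 'rV['F_2]_n -> logicalX :=
  subquotv_class codewordX degenX.
Definition logicalZ_class : 'rV['F_2]_n -> logicalZ :=
  subquotv_class codewordZ degenZ.

HB.instance Definition _ := GRing.Linear.on logicalX_class.
HB.instance Definition _ := GRing.Linear.on logicalZ_class.

(* The subtractions never truncate: see degenX_sub and dim_orthv. *)
Definition css_dim : nat := (n - \dim degenX - \dim degenZ)%N.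

Lemma degenX_sub : (degenX <= codewordX)%VS.
Proof.
have Hdot i j : dotp (row i (css_Hx Q)) (row j (css_Hz Q)) = 0.
  have /matrixP/(_ i j) := css_comm Q; rewrite !mxE => <-.
  by apply: eq_bigr => l _; rewrite !mxE.
apply/span_subvP=> _ /mapP[i _ ->]; apply/memv_orthv=> u uZ; rewrite dotpC.
pose f := linfun (dotp (row i (css_Hx Q)) : _ -> ('F_2)^o).
suff /subvP/(_ u uZ) : (degenZ <= lker f)%VS.
  by rewrite memv_ker lfunE => /eqP.
by apply/span_subvP=> _ /mapP[j _ ->]; rewrite memv_ker lfunE /= Hdot.
Qed.

Lemma degenZ_sub : (degenZ <= codewordZ)%VS.
Proof.
apply/subvP=> v vZ; apply/memv_orthv=> u /(subvP degenX_sub)/memv_orthv.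
by rewrite dotpC; apply.
Qed.

Lemma dim_logicalX : \dim {: logicalX} = css_dim.
Proof. by rewrite [LHS](dim_subquotv degenX_sub) dim_orthv subnAC. Qed.

Lemma dim_logicalZ : \dim {: logicalZ} = css_dim.
Proof. by rewrite [LHS](dim_subquotv degenZ_sub) dim_orthv. Qed.

End CSSCode.

(* Main.v *)
(** Since [alpha] is its own orthogonal, [alpha :&: eta^⊥ = (alpha + eta)^⊥], so
    [\dim (alpha :&: eta^⊥) = n - \dim alpha - \dim eta + \dim (alpha :&: eta)],
    and likewise for [xi]. The image of [alpha :&: eta^⊥] in [eta^⊥ / xi] has
    dimension [\dim (alpha :&: eta^⊥) - \dim (alpha :&: xi)]; adding the analogous
    expression on the Z side, the mixed terms cancel, and [2 \dim alpha = n]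
    leaves [n - \dim xi - \dim eta]. *)
Require Import Defs.
From mathcomp Require Import all_boot all_order all_algebra.
From mathcomp Require Import zify.

Import GRing.Theory.

Local Open Scope ring_scope.

Lemma dimv_le_size n (U : {vspace 'rV['F_2]_n}) : (\dim U <= n)%N.
Proof.
by have := dimvS (subvf U); rewrite [X in (_ <= X)%N]dimvf /dim /= mul1n.
Qed.

Lemma orthvD n (U V : {vspace 'rV['F_2]_n}) :
  orthv (U + V)%VS = (orthv U :&: orthv V)%VS.
Proof.
apply/vspaceP=> v; rewrite memv_cap.
apply/memv_orthv/andP=> [h | [/memv_orthv hU /memv_orthv hV] w].
  by split; apply/memv_orthv=> u uU; apply: h;
    apply: subvP uU; rewrite ?addvSl ?addvSr.
case/memv_addP=> u uU [u' u'V ->].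
by rewrite dotpC linearD /= dotpC hU // dotpC hV // addr0.
Qed.

Lemma dim_cap_orthv n (A U : {vspace 'rV['F_2]_n}) :
  A = orthv A ->
  (\dim (A :&: orthv U) + \dim A + \dim U = n + \dim (A :&: U))%N.
Proof.
move=> selfA; rewrite {1}selfA -orthvD dim_orthv.
(* The bound by [n] keeps [n - \dim (A + U)] from truncating. *)
have := dimv_le_size _ (A + U)%VS; have := dimv_sum_cap A U; lia.
Qed.

Lemma dim_self_orthv n (A : {vspace 'rV['F_2]_n}) :
  A = orthv A -> (\dim A + \dim A = n)%N.
Proof.
move=> selfA; have := dim_orthv A; rewrite -selfA.
have := dimv_le_size _ A; lia.
Qed.

(** Rank-nullity for the class map on [A :&: U]: its kernel there is [A :&: W], and a basis of its
    image supplies the classes. *)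
Lemma subquotv_free_classes (K : fieldType) (V : vectType K)
    (U W A : {vspace V}) :
  (W <= U)%VS ->
  exists d : nat, (d + \dim (A :&: W) = \dim (A :&: U))%N /\
    exists X : d.-tuple (subquotv U W),
      free X /\
      (forall x, x \in X ->
         exists2 v, v \in (A :&: U)%VS & subquotv_class U W v = x).
Proof.
move=> sWU; pose f := linfun (subquotv_class U W).
exists (\dim (f @: (A :&: U))); split.
  rewrite addnC -(limg_ker_dim f (A :&: U)%VS); congr (\dim _ + _)%N.
  apply/vspaceP=> v; rewrite !memv_cap memv_ker lfunE /= -andbA.
  case: (boolP (v \in U)) => [vU|vU] /=; first by rewrite subquotv_class_eq0.
  (* Outside [U] the class of [v] carries no meaning, but [W <= U] keeps such [v] out of [W] as
     well. *)
  by rewrite (contraNF (subvP sWU v) vU).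
exists (vbasis (f @: (A :&: U))); split; first exact: basis_free (vbasisP _).
move=> x /vbasis_mem/memv_imgP[v vAU ->].
by exists v; rewrite ?lfunE.
Qed.

Theorem proposition5p2 (n k : nat) (Q : css_code n)
    (alpha : {vspace 'rV['F_2]_n}) :
  css_dim Q = k ->
  alpha = orthv alpha ->
  exists a b : nat,
    [/\ (a + b)%N = k,
        exists X : a.-tuple (logicalX Q),
          free X /\
          (forall x, x \in X ->
             exists2 v, v \in (alpha :&: codewordX Q)%VS
                      & logicalX_class Q v = x)
      & exists Z : b.-tuple (logicalZ Q),
          free Z /\
          (forall z, z \in Z ->
             exists2 v, v \in (alpha :&: codewordZ Q)%VS
                      & logicalZ_class Q v = z)].
Proof.
move=> <- self_alpha.
have [a [dim_a exX]] := subquotv_free_classes _ _ _ _ alpha (degenX_sub Q).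
have [b [dim_b exZ]] := subquotv_free_classes _ _ _ _ alpha (degenZ_sub Q).
exists a, b; split; [ | exact: exX | exact: exZ].
have dimX := dim_cap_orthv _ _ (degenZ Q) self_alpha.
have dimZ := dim_cap_orthv _ _ (degenX Q) self_alpha.
have dim2 := dim_self_orthv _ _ self_alpha.
rewrite /css_dim; rewrite /codewordX in dim_a; rewrite /codewordZ in dim_b.
(* Summing gives [a + b + \dim (degenX Q) + \dim (degenZ Q) = n], so the subtractions in [css_dim]
   are exact. *)
lia.
Qed.
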